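(* For every $\alpha\in(0,1)$ there exists a constant $C$ depending on $\alpha$ only such that the following holds. Let $n\ge1$, $\tau>0$, $\eta\in[0,1)$, $I=[\sqrt{1-\eta}\,\tau,\tau]$, $\beta\in(0,1-\alpha)$, let $\{S_m,m\in\mathcal M_n\}$ be a finite family of linear subspaces of $\mathbb R^n$ and $(\beta_m)_{m\in\mathcal M_n}$ numbers in $(0,1)$ such that the index $n$ belongs to $\mathcal M_n$, $S_n=\mathbb R^n$, and $\sum_{m\in\mathcal M_n}\beta_m\le\beta$. Put $\mathcal D_m=\dim S_m$ and assume $\mathcal D_m\le n/2$ for all $m\in\mathcal M_n\setminus\{n\}$. Let $\rho_m$ be defined as in the context. Then for all $m\in\mathcal M_n$, $$\rho_m^2\le C\max\{\eta n,\ \mathcal D_m,\ \sqrt{n\log(1/\beta_m)},\ \log(1/\beta_m)\}\,\tau^2 .$$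
   Context: For $z\ge0$ and integer $d\ge1$, $\chi^2_{z,d}(\cdot)$ is the distribution function of the noncentral $\chi^2$ distribution with $d$ degrees of freedom and noncentrality parameter $z$ (the law of $\|\mu+\xi\|^2$ with $\xi$ standard Gaussian in $\mathbb R^d$ and $\|\mu\|^2=z$, of mean $z+d$), and $q_{z,d}(u)$ is its $(1-u)$-quantile: if $X$ has this law then $\mathbb P(X\ge q_{z,d}(u))=u$ for $u\in(0,1)$. Convention: $q_{0,d}(1)=-\infty$. $a\wedge b=\min(a,b)$. Put $N_m=n-\mathcal D_m$. The radii $\rho_m\ge0$ are defined by: for $m=n$, $\rho_n^2=q_{0,n}(\beta_n)\tau^2$; for $m\ne n$ with $\mathcal D_m\ne0$, $$\rho_m^2=\sup_{z\ge0,\ s\in I}\left[z s^2+q_{0,\mathcal D_m}\left(\frac{\beta_m}{\chi^2_{z,N_m}(q_{0,N_m}(\alpha)\tau^2/s^2)}\wedge1\right)s^2\right];$$ for $m\ne n$ with $\mathcal D_m=0$, $$\rho_m^2=\inf\Big\{x\ge0:\ \sup_{s\in I}\chi^2_{x/s^2,n}\big(q_{0,n}(\alpha)\tau^2/s^2\big)\le\beta_m\Big\}.$$ *)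

(* Defs.v *)
From HB Require Import structures.
From mathcomp Require Import all_boot all_order all_algebra.
From mathcomp Require Import all_classical all_reals all_analysis.
From mathcomp Require Import measurable_realfun.

Set Implicit Arguments.
Unset Strict Implicit.
Unset Printing Implicit Defensive.
Import Order.TTheory GRing.Theory Num.Theory.
Import numFieldNormedType.Exports.
Local Open Scope classical_set_scope.
Local Open Scope ring_scope.

Section cons_pair.
Context {d} {T : measurableType d} (n : nat).

Definition cons_pair (p : T * n.-tuple T) : n.+1.-tuple T :=
  [tuple of p.1 :: p.2].

Lemma measurable_cons_pair : measurable_fun [set: T * n.-tuple T] cons_pair.
Proof. exact: measurable_cons. Qed.

HB.instance Definition _ :=
  isMeasurableFun.Build _ _ _ _ cons_pair measurable_cons_pair.

End cons_pair.

Section noncentral_chi2.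
Context {R : realType}.
Local Notation TR := (measurableTypeR R).

(* The standard Gaussian law on R^d, as the d-fold product of N(0, 1). *)
Fixpoint std_gaussian (d : nat) : probability (d.-tuple TR) R :=
  match d with
  | 0 => dirac ([tuple] : 0.-tuple TR)
  | d'.+1 =>
      distribution (normal_prob 0 1 \x std_gaussian d')%E (@cons_pair _ TR d')
  end.

Definition shift_sqnorm (d : nat) (mu xi : d.-tuple TR) : R :=
  \sum_(i < d) ((tnth mu i : R) + (tnth xi i : R)) ^+ 2.

Lemma measurable_shift_sqnorm d mu :
  measurable_fun [set: d.-tuple TR] (shift_sqnorm mu).
Proof.
apply: measurable_sum => i.
by apply: measurable_funX; apply: measurable_funD => //; exact: measurable_tnth.
Qed.

HB.instance Definition _ d mu :=
  isMeasurableFun.Build _ _ _ _ (@shift_sqnorm d mu)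
    (measurable_shift_sqnorm mu).

(* By rotation invariance of [std_gaussian d] the law of [shift_sqnorm mu]
   depends on mu only through its squared norm z; for d >= 1 the vector
   (sqrt z, 0, ..., 0) is a representative. *)
Definition chi2_mean (z : R) (d : nat) : d.-tuple TR :=
  [tuple (if i == 0 :> nat then Num.sqrt z else 0) | i < d].

Definition chi2_rv (z : R) (d : nat) : {RV (std_gaussian d) >-> R} :=
  shift_sqnorm (chi2_mean z d).

Definition chi2_cdf (z : R) (d : nat) (x : R) : R := fine (cdf (chi2_rv z d) x).

(* For 0 < u < 1 and d >= 1 the distribution function is continuous, so that
   this infimum is a real number q with P(X >= q) = u; at u = 1 it is -oo. *)
Definition chi2_quantile (z : R) (d : nat) (u : R) : \bar R :=
  ereal_inf [set x%:E | x in [set x : R | 1 - u <= chi2_cdf z d x]].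

Lemma sqnorm_chi2_mean z d :
  0 <= z -> \sum_(i < d.+1) (tnth (chi2_mean z d.+1) i : R) ^+ 2 = z.
Proof.
move=> z0; rewrite big_ord_recl tnth_mktuple/= sqr_sqrtr// big1 ?addr0// => i _.
by rewrite tnth_mktuple/= expr0n.
Qed.

Lemma chi2_quantile1 z d : chi2_quantile z d 1 = -oo%E.
Proof.
have lb r : (chi2_quantile z d 1 <= r%:E)%E.
  apply: ereal_inf_lbound; exists r => //=.
  by rewrite subrr fine_ge0// cdf_ge0.
case: (chi2_quantile z d 1) lb => [q lb|lb|//]; last by have := lb 0.
by have := lb (q - 1); rewrite lee_fin leNgt gtrBl ltr01.
Qed.

Local Open Scope ereal_scope.

Definition radius_sq_full (tau : R) (n : nat) (b : R) : \bar R :=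
  chi2_quantile 0 n b * (tau ^+ 2)%:E.

(* The quantile inside [t] is finite when 0 < alpha < 1 and 1 <= N, and the
   distribution function in the denominator is positive, as t s > 0. *)
Definition radius_sq_pos (alpha tau : R) (I : set R) (n D : nat) (b : R)
    : \bar R :=
  let N := (n - D)%N in
  let t s := (fine (chi2_quantile 0 N alpha) * tau ^+ 2 / s ^+ 2)%R in
  let u z s := Num.min (b / chi2_cdf z N (t s))%R 1%R in
  ereal_sup [set (zs.1 * zs.2 ^+ 2)%:E
                 + chi2_quantile 0 D (u zs.1 zs.2) * (zs.2 ^+ 2)%:E
            | zs in [set zs : R * R | (0 <= zs.1)%R /\ I zs.2]].

Definition radius_sq_zero (alpha tau : R) (I : set R) (n : nat) (b : R)
    : \bar R :=
  let t s := (fine (chi2_quantile 0 n alpha) * tau ^+ 2 / s ^+ 2)%R in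
  ereal_inf [set x%:E | x in [set x : R | (0 <= x)%R /\
    ereal_sup [set (chi2_cdf (x / s ^+ 2) n (t s))%:E | s in I] <= b%:E]].

(* The square of rho_m, where [top] is the distinguished index n. It lives
   in \bar R: an unbounded supremum, or an infimum over the empty set, is +oo
   and not a junk real number. *)
Definition radius_sq (alpha tau : R) (I : set R) (n : nat) (M : finType)
    (top : M) (S : M -> {vspace 'rV[R]_n}) (beta : M -> R) (m : M) : \bar R :=
  if m == top then radius_sq_full tau n (beta m)
  else if \dim (S m) == 0%N then radius_sq_zero alpha tau I n (beta m)
  else radius_sq_pos alpha tau I n (\dim (S m)) (beta m).

End noncentral_chi2.

(* Main.v *)
(** Completing the square gives the Laplace transform of a noncentral chi-square
    variable X with d degrees of freedom and noncentrality z,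
    E exp(- l X) = (1 + 2 l)^(- d / 2) exp(- l z / (1 + 2 l)), which is at most
    exp((d + z) (4 l^2 - l)) for l >= - 1/4. Chernoff's method then yields
    q_{0,d}(u) <= 4 log(1/u) + 2 d, the sharper q_{0,d}(a) <= d + k_a sqrt d
    whose leading constant 1 is what makes eta n appear instead of n, and, with
    L = log(1/b), z / 2 + N - t <= 8 L + 5 sqrt(N L) as soon as
    b < P(X_{z,N} <= t). A term of the supremum defining rho_m^2 is - oo unless
    beta_m < chi2_{z,N}(t) with t = q_{0,N}(alpha) tau^2 / s^2; multiplying the
    last estimate by s^2, where (1 - eta) tau^2 <= s^2 <= tau^2, then bounds
    z s^2. The term sqrt N is absorbed in sqrt(n L) because
    beta_m < 1 - alpha keeps L away from 0. *)
Require Import Defs.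
From mathcomp Require Import all_boot all_order all_algebra.
From mathcomp Require Import all_classical all_reals all_analysis.
From mathcomp Require Import measurable_realfun ring lra.

Set Implicit Arguments.
Unset Strict Implicit.
Unset Printing Implicit Defensive.
Import Order.TTheory GRing.Theory Num.Theory.
Import numFieldNormedType.Exports.
Local Open Scope classical_set_scope.
Local Open Scope ring_scope.

(** * Gaussian integrals and the Laplace transform of the shifted squared norm *)

Section gaussian.
Context {R : realType}.
Local Notation TR := (measurableTypeR R).
Local Notation mu := (@lebesgue_measure R).

(** The Radon-Nikodym derivative and [normal_pdf] have the same integral over every measurable set,
    hence agree almost everywhere. *)
Lemma ge0_integral_normal_prob (m s : R) (f : R -> \bar R) :
  measurable_fun [set: R] f -> (forall x, (0 <= f x)%E) ->
  (\int[normal_prob m s]_x f x = \int[mu]_x (f x * (normal_pdf m s x)%:E))%E.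
Proof.
move=> mf f0.
have dom := normal_prob_dominates m s.
rewrite -(Radon_Nikodym_SigmaFinite.change_of_variables dom)//.
have mpdf : measurable_fun [set: R] (fun x => (normal_pdf m s x)%:E).
  by apply/measurable_EFinP; exact: measurable_normal_pdf.
have irn := Radon_Nikodym_SigmaFinite.f_integrable dom.
apply: ae_eq_integral => //.
- by apply: emeasurable_funM => //; exact: measurable_int irn.
- exact: emeasurable_funM.
- apply: ae_eqe_mul2l => /=.
  apply: integral_ae_eq => //= E _ mE.
  by rewrite -Radon_Nikodym_SigmaFinite.f_integral.
Qed.

Lemma normal_laplace (l a : R) : 0 < 1 + 2 * l ->
  (\int[normal_prob 0 1]_x (expR (- l * (a + x) ^+ 2))%:E =
   ((Num.sqrt (1 + 2 * l))^-1 * expR (- l * a ^+ 2 / (1 + 2 * l)))%:E)%E.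
Proof.
move=> l0; set k := 1 + 2 * l.
have k0 : k != 0 by rewrite gt_eqF.
have sk : Num.sqrt k ^+ 2 = k by rewrite sqr_sqrtr// ltW.
have sk0 : 0 < Num.sqrt k by rewrite sqrtr_gt0.
have mexp : measurable_fun [set: R] (fun x => expR (- l * (a + x) ^+ 2)).
  apply: measurableT_comp => //; apply: measurable_funM => //.
  by apply: measurable_funX; exact: measurable_funD.
rewrite (@ge0_integral_normal_prob 0 1 (fun x => (expR (- l * (a + x) ^+ 2))%:E));
  [|exact/measurable_EFinP|by move=> x; rewrite lee_fin expR_ge0].
pose m := - (2 * l * a) / k; pose s := (Num.sqrt k)^-1.
have s0 : s != 0 by rewrite invr_neq0// gt_eqF.
(* Completing the square turns the integrand into a multiple of the normal
   density of mean [m] and variance [1 / k]. *)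
transitivity (\int[mu]_x (((Num.sqrt k)^-1 * expR (- l * a ^+ 2 / k))%:E
    * (normal_pdf m s x)%:E))%E.
  apply: eq_integral => x _; rewrite -!EFinM; congr EFin.
  rewrite !normal_pdfE ?oner_neq0// /normal_peak /normal_fun.
  rewrite mulrCA [RHS]mulrACA -!expRD; congr (_ * expR _); last first.
    by rewrite /s exprVn sk /m /k; field; rewrite -/k.
  rewrite /s exprVn sk expr1n -invfM; congr (_^-1).
  rewrite -sqrtrM ?ltW//; congr Num.sqrt.
  by field.
rewrite ge0_integralZl//.
- by rewrite integral_normal_pdf mule1.
- by apply/measurable_EFinP; exact: measurable_normal_pdf.
- by move=> x _; rewrite lee_fin normal_pdf_ge0.
Qed.

(** On the interval of radius sqrt t around [- a] one has |x| <= |a| + sqrt t, so the density is at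
    least the constant [c]. *)
Lemma normal_prob_ball_gt0 (a t : R) : 0 < t ->
  (0 < normal_prob 0 1 [set x : R | (a + x) ^+ 2 <= t]%R)%E.
Proof.
move=> t0; set e := Num.sqrt t.
have e0 : 0 < e by rewrite sqrtr_gt0.
pose c := normal_peak (1 : R) * expR (- (`|a| + e) ^+ 2 / 2).
have c0 : 0 < c by rewrite mulr_gt0 ?normal_peak_gt0 ?oner_neq0 ?expR_gt0.
have mpdf : measurable_fun [set: R] (fun x => (normal_pdf 0 1 x)%:E).
  by apply/measurable_EFinP; exact: measurable_normal_pdf.
have mB : measurable [set x : R | (a + x) ^+ 2 <= t].
  rewrite -[X in measurable X]setTI.
  apply: measurable_fun_le => //; apply: measurable_funX.
  exact: measurable_funD.
apply: (@lt_le_trans _ _ (normal_prob 0 1 `[(- a - e)%R, (- a + e)%R]%classic)); last first.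
  apply: le_measure; rewrite ?inE//= => x /=; rewrite in_itv/= => /andP[h1 h2].
  rewrite -(sqr_sqrtr (ltW t0)) -/e -subr_ge0 subr_sqr mulr_ge0//; lra.
apply: (@lt_le_trans _ _ (\int[mu]_(x in `[(- a - e)%R, (- a + e)%R]) c%:E)%E).
  rewrite integral_cst//= lebesgue_measure_itv/= lte_fin.
  have -> : - a - e < - a + e by lra.
  rewrite -EFinB -EFinM lte_fin; apply: mulr_gt0 => //; lra.
rewrite /normal_prob; apply: ge0_le_integral => //=.
- by move=> x _; rewrite lee_fin ltW.
- exact: measurable_funS mpdf.
- move=> x; rewrite in_itv/= => /andP[h1 h2]; rewrite lee_fin.
  rewrite normal_pdfE ?oner_neq0// /normal_fun expr1n subr0 /c.
  rewrite ler_pM2l ?normal_peak_gt0 ?oner_neq0// ler_expR !mulNr lerN2.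
  rewrite ler_pM2r ?invr_gt0// -subr_ge0 subr_sqr.
  have := ler_norm a; have := ler_norm (- a).
  by rewrite normrN => ? ?; rewrite mulr_ge0//; lra.
Qed.

Lemma integral_std_gaussianS d (f : R -> \bar R) (g : d.-tuple TR -> \bar R)
    (h : d.+1.-tuple TR -> \bar R) :
  measurable_fun [set: R] f -> (forall x, (0 <= f x)%E) ->
  measurable_fun [set: d.-tuple TR] g -> (forall x, (0 <= g x)%E) ->
  measurable_fun [set: d.+1.-tuple TR] h -> (forall x, (0 <= h x)%E) ->
  (forall x y, h (cons_pair (x, y)) = (f x * g y)%E) ->
  (\int[std_gaussian d.+1]_x h x =
   (\int[normal_prob 0 1]_x f x) * \int[std_gaussian d]_x g x)%E.
Proof.
move=> mf f0 mg g0 mh h0 hE /=.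
rewrite ge0_integral_distribution// fubini_tonelli1/=; first last.
- by move=> x; exact: h0.
- by apply: measurableT_comp => //; exact: measurable_cons_pair.
transitivity (\int[normal_prob 0 1]_x (f x * \int[std_gaussian d]_y g y))%E.
  apply: eq_integral => x _; rewrite /fubini_F -ge0_integralZl//.
  by apply: eq_integral => y _ /=; rewrite hE.
by rewrite ge0_integralZr// integral_ge0.
Qed.

Lemma shift_sqnorm_cons d (a x : R) (v y : d.-tuple TR) :
  shift_sqnorm [tuple of a :: v] (cons_pair (x, y)) =
  (a + x) ^+ 2 + shift_sqnorm v y.
Proof.
rewrite /shift_sqnorm big_ord_recl; congr (_ + _).
by apply: eq_bigr => i _; rewrite !tnthS.
Qed.

(** Coordinates are independent, so the transform factorises by induction on [d]; the shift enters
    only through its squared norm. *)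
Lemma std_gaussian_laplace d (l : R) (v : d.-tuple TR) : 0 < 1 + 2 * l ->
  (\int[std_gaussian d]_x (expR (- l * shift_sqnorm v x))%:E =
   ((Num.sqrt (1 + 2 * l))^-1 ^+ d *
    expR (- l * (\sum_(i < d) (tnth v i : R) ^+ 2) / (1 + 2 * l)))%:E)%E.
Proof.
move=> l0.
have mexp n (w : n.-tuple TR) : measurable_fun [set: n.-tuple TR]
    (fun x => (expR (- l * shift_sqnorm w x))%:E).
  apply/measurable_EFinP; apply: measurableT_comp => //.
  by apply: measurable_funM => //; exact: measurable_shift_sqnorm.
elim: d v => [|d IH] v.
  rewrite /= integral_dirac//; last exact: mexp.
  rewrite diracE mem_set// mul1e /shift_sqnorm !big_ord0.
  by rewrite !mulr0 mul0r expR0 expr0 mulr1.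
case/tupleP: v => a v.
rewrite (@integral_std_gaussianS _ (fun x => (expR (- l * (a + x) ^+ 2))%:E)
   (fun y => (expR (- l * shift_sqnorm v y))%:E))//.
- rewrite normal_laplace// IH -EFinM; congr EFin.
  rewrite mulrACA -expRD -exprS; congr (_ * expR _).
  rewrite big_ord_recl tnth0 -mulrDl -mulrDr; congr (_ * (_ + _) / _).
  by apply: eq_bigr => i _; rewrite tnthS.
- apply/measurable_EFinP; apply: measurableT_comp => //.
  apply: measurable_funM => //.
  by apply: measurable_funX; exact: measurable_funD.
- by move=> x y; rewrite shift_sqnorm_cons mulrDr expRD EFinM.
Qed.

(** The product of two lower-dimensional balls at level [t / 2] lies in the ball at level [t]. This
    makes the denominators in the radius positive. *)
Lemma std_gaussian_ball_gt0 d (v : d.-tuple TR) (t : R) : 0 < t ->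
  (0 < std_gaussian d [set x | shift_sqnorm v x <= t]%R)%E.
Proof.
elim: d v t => [|d IH] v t t0.
  rewrite /= diracE mem_set ?lte01//=.
  by rewrite /shift_sqnorm big_ord0 ltW.
case/tupleP: v => a v.
have t20 : 0 < t / 2 by lra.
have mb n (w : n.-tuple TR) (r : R) :
    measurable [set x | shift_sqnorm w x <= r]%R.
  rewrite -[X in measurable X]setTI.
  by apply: measurable_fun_le => //; exact: measurable_shift_sqnorm.
have mb1 (r : R) : measurable [set x : R | (a + x) ^+ 2 <= r].
  rewrite -[X in measurable X]setTI.
  apply: measurable_fun_le => //; apply: measurable_funX.
  exact: measurable_funD.
rewrite /= /distribution /pushforward.
apply: (@lt_le_trans _ _ ((normal_prob 0 1 \x std_gaussian d)%E
   ([set x : R | (a + x) ^+ 2 <= t / 2]%R `*`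
    [set y | shift_sqnorm v y <= t / 2]%R))).
  rewrite product_measure1E; [|exact: mb1|exact: mb].
  by apply: mule_gt0; [exact: normal_prob_ball_gt0|exact: IH].
apply: le_measure; rewrite ?inE.
- by apply: measurableX; [exact: mb1|exact: mb].
- rewrite -[X in measurable X]setTI; apply: measurable_cons_pair => //.
  exact: mb.
- by move=> [x y] [/= hx hy]; rewrite /= shift_sqnorm_cons; lra.
Qed.

End gaussian.

(** * Chernoff bounds for distribution functions and quantiles *)

Section chi2_tails.
Context {R : realType}.
Local Notation TR := (measurableTypeR R).

(** Apply 1 + x <= exp x at x = 2 u^2 - u: the product (1 + u) (1 - u + 2 u^2) = 1 + u^2 (1 + 2 u)
    is at least 1 for u >= - 1/2. *)
Lemma expR_le_1D (u : R) : - 2^-1 <= u -> expR (u - 2 * u ^+ 2) <= 1 + u.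
Proof.
move=> hu.
have := expR_ge1Dx (- (u - 2 * u ^+ 2)); rewrite expRN => h.
have e0 := expR_gt0 (u - 2 * u ^+ 2).
rewrite -(ler_pM2r (_ : 0 < (expR (u - 2 * u ^+ 2))^-1)) ?invr_gt0//.
rewrite divff ?gt_eqF//; apply: le_trans (ler_wpM2l _ h); last lra.
nra.
Qed.

(** Markov's inequality for exp(l (x - X)). The sign of [l] is free: l >= 0 treats {X <= x} and l <=
    0 treats {X > x}. *)
Lemma prob_le_laplace d (T : measurableType d) (P : probability T R)
    (X : {RV P >-> R}) (A : set T) (l x : R) :
  measurable A -> (forall w, A w -> 0 <= l * (x - X w)) ->
  (P A <= (expR (l * x))%:E * \int[P]_w (expR (- l * X w))%:E)%E.
Proof.
move=> mA hA.
have mexp : measurable_fun [set: T] (fun w => (expR (- l * X w))%:E).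
  by apply/measurable_EFinP; apply: measurableT_comp => //; exact: measurable_funM.
rewrite -ge0_integralZl//; [|by move=> w _; rewrite lee_fin expR_ge0..].
rewrite -[A in leLHS]setIT -integral_indic//.
apply: ge0_le_integral => //=.
- by apply/measurable_EFinP; exact: measurable_indic.
- by apply: emeasurable_funM.
- move=> w _; rewrite -EFinM lee_fin -expRD indicE.
  have [/set_mem Aw|_] := boolP (w \in A); last exact: expR_ge0.
  have := hA _ Aw; rewrite mulrBr mulNr => h.
  by rewrite -expR0 ler_expR.
Qed.

(** The dimension is a successor because [chi2_mean z 0] is empty and has squared norm 0 instead of
    [z]. *)
Lemma chi2_laplace (l z : R) d : 0 <= z -> 0 < 1 + 2 * l ->
  (\int[std_gaussian d.+1]_x (expR (- l * chi2_rv z d.+1 x))%:E =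
   ((Num.sqrt (1 + 2 * l))^-1 ^+ d.+1 * expR (- l * z / (1 + 2 * l)))%:E)%E.
Proof.
by move=> z0 l0; rewrite (std_gaussian_laplace (chi2_mean z d.+1) l0) sqnorm_chi2_mean.
Qed.

(** The factors are bounded separately: [expR_le_1D] at u = 2 l handles (1 + 2 l)^(- 1/2), and the
    exponents in z differ by a positive multiple of z l^2 (1 + 4 l). Both steps use l >= - 1/4. *)
Lemma chi2_laplace_le (l z : R) d : 0 <= z -> - 4^-1 <= l ->
  (Num.sqrt (1 + 2 * l))^-1 ^+ d.+1 * expR (- l * z / (1 + 2 * l)) <=
  expR ((d.+1%:R + z) * (4 * l ^+ 2 - l)).
Proof.
move=> z0 hl.
have k0 : 0 < 1 + 2 * l by lra.
have s0 : 0 < Num.sqrt (1 + 2 * l) by rewrite sqrtr_gt0.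
rewrite [in leRHS]mulrDl expRD; apply: ler_pM.
- by rewrite exprn_ge0// invr_ge0 ltW.
- exact: expR_ge0.
- rewrite expRM_natl lerXn2r ?nnegrE ?invr_ge0 ?expR_ge0 ?(ltW s0)//.
  rewrite -opprB expRN lef_pV2 ?posrE ?expR_gt0//.
  rewrite -[leLHS]ger0_norm ?expR_ge0// -sqrtr_sqr ler_sqrt; last exact: ltW.
  rewrite expr2 -expRD; have := @expR_le_1D (2 * l).
  have -> : 2 * l - 2 * (2 * l) ^+ 2 = l - 4 * l ^+ 2 + (l - 4 * l ^+ 2) by ring.
  by apply; lra.
- rewrite ler_expR ler_pdivrMr// -subr_ge0.
  have -> : z * (4 * l ^+ 2 - l) * (1 + 2 * l) - - l * z
    = 2 * (z * l ^+ 2) * (1 + 4 * l) by ring.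
  have zl : 0 <= z * l ^+ 2 by rewrite mulr_ge0 ?sqr_ge0.
  by apply: mulr_ge0; lra.
Qed.

Lemma chi2_cdfE (z x : R) d :
  (chi2_cdf z d x)%:E = std_gaussian d [set w | chi2_rv z d w <= x]%R.
Proof.
by rewrite /chi2_cdf fineK ?fin_num_measure.
Qed.

Lemma measurable_chi2_le (z x : R) d :
  measurable [set w : d.-tuple TR | chi2_rv z d w <= x]%R.
Proof.
rewrite -[X in measurable X]setTI.
by apply: measurable_fun_le => //; exact: measurable_funPT.
Qed.

Lemma chi2_cdf_le1 (z x : R) d : chi2_cdf z d x <= 1.
Proof. by rewrite -lee_fin chi2_cdfE probability_le1//; exact: measurable_chi2_le. Qed.

Lemma chi2_cdf_gt0 (z x : R) d : 0 < x -> 0 < chi2_cdf z d x.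
Proof. by move=> x0; rewrite -lte_fin chi2_cdfE; exact: std_gaussian_ball_gt0. Qed.

Lemma chi2_cdf_le_laplace (z x l : R) d : 0 <= z -> 0 <= l ->
  chi2_cdf z d.+1 x <= expR (l * x) *
   ((Num.sqrt (1 + 2 * l))^-1 ^+ d.+1 * expR (- l * z / (1 + 2 * l))).
Proof.
move=> z0 l0; have k0 : 0 < 1 + 2 * l by lra.
rewrite -lee_fin chi2_cdfE EFinM -chi2_laplace//.
apply: prob_le_laplace; first exact: measurable_chi2_le.
by move=> w /= h; rewrite mulr_ge0// subr_ge0.
Qed.

Lemma chi2_cdf_le_expR (z x l : R) d : 0 <= z -> 0 <= l ->
  chi2_cdf z d.+1 x <= expR (l * x + (d.+1%:R + z) * (4 * l ^+ 2 - l)).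
Proof.
move=> z0 l0; apply: le_trans (chi2_cdf_le_laplace x d z0 l0) _.
by rewrite expRD ler_wpM2l ?expR_ge0// chi2_laplace_le//; lra.
Qed.

Lemma chi2_cdf_ge_expR (z x l : R) d : 0 <= z -> - 4^-1 <= l <= 0 ->
  1 - expR (l * x + (d.+1%:R + z) * (4 * l ^+ 2 - l)) <= chi2_cdf z d.+1 x.
Proof.
move=> z0 /andP[l1 l0]; have k0 : 0 < 1 + 2 * l by lra.
suff : 1 - chi2_cdf z d.+1 x
    <= expR (l * x + (d.+1%:R + z) * (4 * l ^+ 2 - l)) by lra.
have mA := @measurable_chi2_le z x d.+1.
rewrite -lee_fin EFinB chi2_cdfE -probability_setC//.
apply: (@le_trans _ _ ((expR (l * x))%:E *
    \int[std_gaussian d.+1]_w (expR (- l * chi2_rv z d.+1 w))%:E)%E).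
  apply: prob_le_laplace; first exact: measurableC.
  move=> w /= /negP; rewrite -ltNge => h.
  by rewrite -mulrNN opprB mulr_ge0//; lra.
rewrite chi2_laplace// -EFinM lee_fin expRD ler_wpM2l ?expR_ge0//.
exact: chi2_laplace_le.
Qed.

Lemma chi2_quantile_le_cdf (z u x : R) d :
  1 - u <= chi2_cdf z d x -> (chi2_quantile z d u <= x%:E)%E.
Proof. by move=> h; apply: ereal_inf_lbound; exists x. Qed.

Lemma chi2_quantile_le_ln (u : R) d : (0 < d)%N -> 0 < u ->
  (chi2_quantile 0 d u <= (4 * ln (1 / u) + 2 * d%:R)%:E)%E.
Proof.
case: d => // d _ u0; apply: chi2_quantile_le_cdf.
(* At l = - 1/4 the exponent is half the dimension minus x / 4, which equals [ln u] for this x. *)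
apply: le_trans (@chi2_cdf_ge_expR 0 _ (- 4^-1) d _ _); [|lra..].
rewrite lerD2l lerN2 div1r lnV ?posrE//.
rewrite -[leRHS](lnK (_ : u \in Num.pos)) ?posrE// ler_expR; lra.
Qed.

Lemma chi2_quantile_le_sqrt (a : R) d : (0 < d)%N -> 0 < a < 1 ->
  (chi2_quantile 0 d a <=
   (d%:R + (1 + 4 * ln (1 / a)) * Num.sqrt d%:R)%:E)%E.
Proof.
case: d => // d _ /andP[a0 a1]; apply: chi2_quantile_le_cdf.
set N : R := d.+1%:R; set w := Num.sqrt N.
have N1 : 1 <= N by rewrite ler1n.
have wN : w ^+ 2 = N by rewrite sqr_sqrtr//; lra.
have w1 : 1 <= w by rewrite -sqrtr1 ler_sqrt//; lra.
have wv : w * w^-1 = 1 by rewrite divff//; lra.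
have v0 : 0 < w^-1 by rewrite invr_gt0; lra.
(* With l = - 1 / (4 w) and w^2 = N, the terms l N cancel and 4 N l^2 = 1/4, leaving exactly [ln a];
   w >= 1 ensures l >= - 1/4. *)
apply: le_trans (@chi2_cdf_ge_expR 0 _ (- (4^-1 * w^-1)) d _ _).
- rewrite lerD2l lerN2 div1r lnV ?posrE//.
  rewrite -[leRHS](lnK (_ : a \in Num.pos)) ?posrE// ler_expR -/N -wN addr0.
  have -> : - (4^-1 * w^-1) * (w ^+ 2 + (1 + 4 * - ln a) * w) +
    w ^+ 2 * (4 * (- (4^-1 * w^-1)) ^+ 2 - - (4^-1 * w^-1)) =
    4^-1 * (w * w^-1) ^+ 2 - 4^-1 * (w * w^-1) * (1 + 4 * - ln a) by field; lra.
  rewrite wv; lra.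
- lra.
- nra.
Qed.

(** As [fine] sends infinite values to 0, positivity also shows that the quantile is finite. *)
Lemma chi2_quantile_gt0 (a : R) d : (0 < d)%N -> 0 < a < 1 ->
  0 < fine (chi2_quantile 0 d a).
Proof.
case: d => // d _ /andP[a0 a1].
(* With [l = c ^+ 2] the Laplace bound on the distribution function at
   [x < 1 / l] is at most [e / sqrt (1 + 2 l) < 1 - a]. *)
pose c : R := expR 1 / (1 - a).
have c0 : 0 < c by rewrite divr_gt0 ?expR_gt0//; lra.
have l0 : 0 < c ^+ 2 by rewrite exprn_gt0.
have qlb : (((c ^+ 2)^-1)%:E <= chi2_quantile 0 d.+1 a)%E.
  apply/ereal_infP => _ [x /= hx <-]; rewrite lee_fin leNgt; apply/negP => xl.
  have := chi2_cdf_le_laplace (z := 0) x d (lexx 0) (ltW l0).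
  apply/negP; rewrite -ltNge; apply: lt_le_trans hx.
  rewrite mulr0 mul0r expR0 mulr1.
  have sc : c < Num.sqrt (1 + 2 * c ^+ 2).
    rewrite -[ltLHS]ger0_norm ?ltW// -sqrtr_sqr.
    by rewrite ltr_sqrt; move: (c ^+ 2) l0 => q q0; lra.
  have -> : 1 - a = expR 1 * c^-1.
    by rewrite /c invf_div mulrC divfK// gt_eqF ?expR_gt0.
  apply: (@le_lt_trans _ _ (expR 1 * (Num.sqrt (1 + 2 * c ^+ 2))^-1)); last first.
    by rewrite ltr_pM2l ?expR_gt0// ltf_pV2 ?posrE// (lt_trans c0).
  apply: ler_pM; rewrite ?expR_ge0 ?exprn_ge0 ?invr_ge0 ?sqrtr_ge0//.
    by rewrite ler_expR -ler_pdivlMl// mulr1 ltW.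
  rewrite exprS ler_piMr ?invr_ge0 ?sqrtr_ge0// exprn_ile1 ?invr_ge0 ?sqrtr_ge0//.
  rewrite invf_le1; last exact: lt_trans sc.
  by rewrite -[leLHS]sqrtr1 ler_sqrt; move: (c ^+ 2) l0 => q q0; lra.
have := @chi2_quantile_le_sqrt a d.+1; rewrite a0 a1 => /(_ isT isT).
case: chi2_quantile qlb => [q|//|//]; rewrite lee_fin /= => h _.
by apply: lt_le_trans h; rewrite invr_gt0.
Qed.

Lemma noncentrality_le (z t b : R) d : (0 < d)%N -> 0 <= z -> 0 < b < 1 ->
  b < chi2_cdf z d t ->
  z / 2 + d%:R - t <= 8 * ln (1 / b) + 5 * Num.sqrt (d%:R * ln (1 / b)).
Proof.
case: d => // d _ z0 /andP[b0 b1] hb.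
set N : R := d.+1%:R; set L := ln (1 / b).
have N1 : 1 <= N by rewrite ler1n.
have L0 : 0 < L by rewrite /L ln_gt0// ltr_pdivlMr// mul1r.
set w := Num.sqrt (N * L).
have w0 : 0 < w by rewrite sqrtr_gt0 mulr_gt0//; lra.
have wE : w * w = N * L by rewrite -expr2 sqr_sqrtr// mulr_ge0//; lra.
have key (l : R) : 0 < l -> l <= 8^-1 ->
    l * (z / 2 + N - t) <= L + 4 * l ^+ 2 * N.
  move=> l0 l8.
  have := lt_le_trans hb (chi2_cdf_le_expR t d z0 (ltW l0)).
  rewrite -[ltLHS](lnK (_ : b \in Num.pos)) ?posrE// ltr_expR -/N.
  have -> : ln b = - L by rewrite /L div1r lnV ?posrE// opprK.
  have h : 0 <= z * (l * (8^-1 - l)) by rewrite !mulr_ge0//; lra.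
  nra.
(* [l] is the minimum of [sqrt (L / N)], which balances [L / l] against [l N],
   and of [1 / 8], below which [z (l - 4 l^2) >= z l / 2]. *)
have [hw|hw] := lerP (8 * w) N.
  have l0 : 0 < w / N by rewrite divr_gt0//; lra.
  have l8 : w / N <= 8^-1 by rewrite ler_pdivrMr; lra.
  have := key _ l0 l8.
  have -> : L + 4 * (w / N) ^+ 2 * N = w / N * (5 * w).
    have -> : L = w * w / N by rewrite wE mulrC mulKf//; lra.
    by field; lra.
  rewrite ler_pM2l//; lra.
(* Here N < 8 w, so l = 1/8 gives the bound 8 L + N / 2 <= 8 L + 4 w. *)
by have := key (8^-1) ltac:(lra) (lexx _); lra.
Qed.

End chi2_tails.

(** * The rate and the bound on the scaled noncentrality *)

Section radius.
Context {R : realType}.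

Definition rate (eta L : R) (n D : nat) : R :=
  Num.max (eta * n%:R) (Num.max D%:R (Num.max (Num.sqrt (n%:R * L)) L)).

Lemma rate_ge (eta L : R) n D :
  [/\ eta * n%:R <= rate eta L n D, D%:R <= rate eta L n D,
      Num.sqrt (n%:R * L) <= rate eta L n D & L <= rate eta L n D].
Proof. by rewrite /rate; split; rewrite !le_max lexx ?orbT. Qed.

(** 28 = 2 (1 + 8 + 5): 1 comes from eta N, 8 and 5 from [noncentrality_le], and the factor 2 undoes
    z / 2. The fraction turns the sqrt N term of the quantile into a multiple of [rate]. *)
Definition rate_cst (alpha : R) : R :=
  28 + 2 * ((1 + 4 * ln (1 / alpha)) / Num.sqrt (ln (1 / (1 - alpha)))).

(** Multiplying [noncentrality_le] by s^2 leaves q tau^2 - d s^2, whose leading part d (tau^2 - s^2)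
    is at most eta d tau^2. [D] is independent of [d], so that d = n - D and d = n are both
    covered. *)
Lemma scaled_noncentrality_le (alpha eta tau s z b : R) (n d D : nat) :
  0 < alpha < 1 -> 0 <= eta < 1 -> 0 < tau -> 0 < s ->
  (1 - eta) * tau ^+ 2 <= s ^+ 2 <= tau ^+ 2 -> 0 <= z ->
  0 < b < 1 - alpha -> (0 < d)%N -> (d <= n)%N ->
  b < chi2_cdf z d (fine (chi2_quantile 0 d alpha) * tau ^+ 2 / s ^+ 2) ->
  z * s ^+ 2 <= rate_cst alpha * rate eta (ln (1 / b)) n D * tau ^+ 2.
Proof.
move=> al01 /andP[eta0 eta1] tau0 s0 /andP[s1 s2] z0 /andP[b0 ba] d0 dn hb.
have /andP[al0 al1] := al01.
set q := fine _ in hb; set L := ln (1 / b); set N : R := d%:R.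
have N1 : 1 <= N by rewrite ler1n.
have Nn : N <= n%:R by rewrite ler_nat.
have b1 : 0 < b < 1 by apply/andP; split; lra.
set k := 1 + 4 * ln (1 / alpha).
have k0 : 0 <= k.
  have : 0 < ln (1 / alpha) by rewrite ln_gt0// ltr_pdivlMr// mul1r.
  rewrite /k; lra.
have qle : q <= N + k * Num.sqrt N.
  have := chi2_quantile_le_sqrt d0 al01; have := chi2_quantile_gt0 d0 al01.
  by rewrite /q; case: chi2_quantile => [r|//|]/=; rewrite ?ltxx// lee_fin.
have := noncentrality_le d0 z0 b1 hb; rewrite -/N -/L => dev.
set L0 := ln (1 / (1 - alpha)).
have L00 : 0 < L0 by rewrite /L0 ln_gt0// ltr_pdivlMr; lra.
have L0L : L0 <= L.
  have al10 : 0 < 1 - alpha by lra.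
  by rewrite ler_ln ?posrE ?divr_gt0// !div1r lef_pV2 ?posrE//; lra.
have [r1 r2 r3 r4] := rate_ge eta L n D.
set M := rate eta L n D in r1 r2 r3 r4 *.
have wM : Num.sqrt (N * L) <= M.
  by apply: le_trans r3; rewrite ler_wsqrtr// ler_wpM2r//; lra.
have sN : Num.sqrt N <= M / Num.sqrt L0.
  rewrite ler_pdivlMr ?sqrtr_gt0// -sqrtrM; last lra.
  by apply: le_trans wM; rewrite ler_wsqrtr// ler_wpM2l//; lra.
have ksN : k * Num.sqrt N <= k / Num.sqrt L0 * M.
  by rewrite mulrAC -mulrA ler_wpM2l.
have eN : eta * N <= M by apply: le_trans r1; rewrite ler_wpM2l.
have t20 : 0 < tau ^+ 2 by rewrite exprn_gt0.
have s20 : 0 < s ^+ 2 by rewrite exprn_gt0.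
move: dev; set t := q * tau ^+ 2 / s ^+ 2 => dev.
have tE : t * s ^+ 2 = q * tau ^+ 2 by rewrite /t divfK// gt_eqF.
have M0 : 0 <= M by lra.
have w0 := sqrtr_ge0 (N * L).
rewrite /rate_cst -/k -/L0; set K := k / _ in ksN *.
(* From here [s] and [tau] stand for the squares, so that products such as N s become atoms of
   linear arithmetic. *)
move: {tau0 s0 hb} (s ^+ 2) (tau ^+ 2) @t s1 s2 t20 s20 tE dev =>
  {}s {}tau t s1 s2 tau0 s0 tE dev.
have e1 : z / 2 * s <= t * s - N * s + (8 * L + 5 * Num.sqrt (N * L)) * s.
  by rewrite -mulrBl -mulrDl ler_wpM2r//; lra.
have e2 : (8 * L + 5 * Num.sqrt (N * L)) * s <= 13 * M * tau.
  by apply: ler_pM; lra.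
have e3 : t * s <= (N + K * M) * tau by rewrite tE ler_wpM2r//; lra.
have e4 : N * ((1 - eta) * tau) <= N * s by rewrite ler_wpM2l//; lra.
have e5 : eta * N * tau <= M * tau by rewrite ler_wpM2r//; lra.
lra.
Qed.

End radius.

Theorem proposition3p1 (R : realType) (alpha : R) :
  0 < alpha < 1 ->
  exists C : R,
  forall (n : nat) (tau eta beta : R) (M : finType) (top : M)
         (S : M -> {vspace 'rV[R]_n}) (beta_ : M -> R),
    (1 <= n)%N ->
    0 < tau ->
    0 <= eta < 1 ->
    0 < beta < 1 - alpha ->
    S top = fullv ->
    (forall m : M, 0 < beta_ m < 1) ->
    \sum_(m : M) beta_ m <= beta ->
    (forall m : M, m != top -> (\dim (S m))%:R <= n%:R / 2 :> R) ->
  forall m : M,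
    (radius_sq alpha tau `[(Num.sqrt (1 - eta) * tau)%R, tau]%classic top S beta_ m
     <= (C * Num.max (eta * n%:R)
              (Num.max (\dim (S m))%:R
                (Num.max (Num.sqrt (n%:R * ln (1 / beta_ m)))
                   (ln (1 / beta_ m)))) * tau ^+ 2)%R%:E)%E.
Proof.
(* The extra 6 = 4 + 2 pays for the quantile bound 4 log(1/u) + 2 D_m. *)
move=> al01; exists (rate_cst alpha + 6) => n tau eta beta M top S beta_ n1 tau0.
move=> eta01 /andP[beta0 beta1] Stop beta01 sumb dimS m.
have /andP[al0 al1] := al01; have /andP[eta0 eta1] := eta01.
have /andP[b0 b1] := beta01 m.
have ba : beta_ m < 1 - alpha.
  apply: le_lt_trans beta1; apply: le_trans sumb.
  rewrite (bigD1 m)//= lerDl; apply: sumr_ge0 => i _.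
  by have /andP[/ltW] := beta01 i.
set b := beta_ m in b0 b1 ba *; have b0a : 0 < b < 1 - alpha by rewrite b0.
set L := ln (1 / b).
have L0 : 0 < L by rewrite /L ln_gt0// ltr_pdivlMr// mul1r.
have [r1 r2 r3 r4] := rate_ge eta L n (\dim (S m)).
rewrite -/(rate eta L n (\dim (S m))).
set K := rate eta L n _ in r1 r2 r3 r4 *.
have K0 : 0 < K by lra.
have t20 : 0 < tau ^+ 2 by rewrite exprn_gt0.
have c0 : 28 <= rate_cst alpha.
  rewrite /rate_cst lerDl mulr_ge0// divr_ge0 ?sqrtr_ge0//.
  have : 0 < ln (1 / alpha) by rewrite ln_gt0// ltr_pdivlMr// mul1r.
  lra.
have sI (s : R) : `[(Num.sqrt (1 - eta) * tau)%R, tau]%classic s ->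
    0 < s /\ (1 - eta) * tau ^+ 2 <= s ^+ 2 <= tau ^+ 2.
  rewrite /= in_itv/= => /andP[s1 s2].
  have e0 : 0 < Num.sqrt (1 - eta) * tau by rewrite mulr_gt0// sqrtr_gt0; lra.
  have s0 := lt_le_trans e0 s1; split=> //.
  rewrite -[X in X * _]sqr_sqrtr; last lra.
  by rewrite -exprMn !lerXn2r ?nnegrE//; lra.
rewrite /radius_sq; case: eqVneq => [mtop|mtop].
  have dS : \dim (S m) = n by rewrite mtop Stop dimvf /dim/= mul1n.
  rewrite /radius_sq_full -/b.
  apply: le_trans (lee_wpmul2r _ (chi2_quantile_le_ln n1 b0)) _.
    by rewrite lee_fin ltW.
  rewrite -EFinM lee_fin ler_wpM2r ?(ltW t20)// -/L.
  have cK : 0 <= rate_cst alpha * K by rewrite mulr_ge0//; lra.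
  by move: r2; rewrite dS; lra.
(* D_m <= n / 2 and n >= 1 make the inequality strict, so that N_m >= 1. *)
have dn : (\dim (S m) < n)%N.
  have := dimS _ mtop; rewrite -(ltr_nat R) => h.
  have : 1 <= n%:R :> R by rewrite ler1n.
  lra.
case: eqP => [D0|/eqP Dn0].
  rewrite /radius_sq_zero -/b; apply: ereal_inf_lbound.
  (* The claimed bound is itself admissible in the infimum: if the distribution function exceeded
     [b] for some s, [scaled_noncentrality_le] would force this number below
     [rate_cst alpha * K * tau ^+ 2], while K > 0. *)
  exists ((rate_cst alpha + 6) * K * tau ^+ 2) => //=; split.
    by rewrite !mulr_ge0 ?ltW//; lra.
  apply: ge_ereal_sup => _ [s /sI[s0 s12] <-]; rewrite lee_fin leNgt.
  have s20 : 0 < s ^+ 2 by rewrite exprn_gt0.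
  apply/negP => hb.
  have z0 : 0 <= (rate_cst alpha + 6) * K * tau ^+ 2 / s ^+ 2.
    by rewrite !mulr_ge0 ?invr_ge0 ?ltW//; lra.
  have := scaled_noncentrality_le (\dim (S m)) al01 eta01 tau0 s0 s12 z0 b0a n1
    (leqnn _) hb.
  rewrite divfK ?gt_eqF// -/L -/K ler_pM2r// ler_pM2r//; lra.
rewrite /radius_sq_pos -/b; apply: ge_ereal_sup => _ [[z s] [/= z0 /sI[s0 s12]] <-].
have s20 : 0 < s ^+ 2 by rewrite exprn_gt0.
set t := _ / s ^+ 2.
have N0 : (0 < n - \dim (S m))%N by rewrite subn_gt0.
(* Without positivity of the denominator, [b / 0 = 0] would make the quantile
   [+oo]. *)
have t0 : 0 < t.
  by rewrite /t divr_gt0// mulr_gt0// chi2_quantile_gt0.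
have p0 := chi2_cdf_gt0 z (n - \dim (S m)) t0.
have p1 := chi2_cdf_le1 z t (n - \dim (S m)).
set p := chi2_cdf _ _ _ in p0 p1 *.
(* If p <= b, the minimum is 1 and the quantile is - oo, hence so is the whole term. *)
have [pb|bp] := lerP p b.
  rewrite min_r; last by rewrite ler_pdivlMr// mul1r.
  by rewrite chi2_quantile1 gt0_mulNye ?lte_fin// addeNy leNye.
have u0 : 0 < b / p by rewrite divr_gt0.
rewrite min_l; last by rewrite ler_pdivrMr// mul1r ltW.
have zs : z * s ^+ 2 <= rate_cst alpha * K * tau ^+ 2.
  exact: scaled_noncentrality_le (leq_subr _ _) bp.
apply: (@le_trans _ _
  (z * s ^+ 2 + (4 * ln (1 / (b / p)) + 2 * (\dim (S m))%:R) * s ^+ 2)%R%:E)%E.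
  rewrite EFinD leeD2l// [leRHS]EFinM; apply: lee_wpmul2r; first by rewrite lee_fin ltW.
  by apply: chi2_quantile_le_ln => //; rewrite lt0n.
rewrite lee_fin.
(* p <= 1 gives b / p >= b. *)
have lnp : ln (1 / (b / p)) <= L.
  rewrite ler_ln ?posrE ?divr_gt0// !div1r lef_pV2 ?posrE//.
  by rewrite ler_pdivlMr// ler_piMr// ltW.
have : (4 * ln (1 / (b / p)) + 2 * (\dim (S m))%:R) * s ^+ 2 <= 6 * K * tau ^+ 2.
  have h : 4 * ln (1 / (b / p)) + 2 * (\dim (S m))%:R <= 6 * K by lra.
  apply: le_trans (ler_wpM2r (ltW s20) h) _.
  by case/andP: s12 => _ ?; rewrite ler_wpM2l//; lra.
lra.
Qed.
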